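(* Let $T>0$. Then there exists $u_0\in L^2(\mathbb{R}^+)$ such that, if $u\in L^\infty(0,T;L^2(\mathbb{R}^+))$ satisfies $$\begin{cases}u_t-u_{xxx}-u_{xx}=0 & \text{in } \mathcal{D}'((0,\infty)\times(0,T)),\\ u(x,0)=u_0(x),\end{cases}$$ then $u(\cdot,T)\neq0$.
   Context: $\mathbb{R}^+=(0,\infty)$; the first variable is $x\in(0,\infty)$ and the second is $t\in(0,T)$. $\mathcal{D}'$ denotes the space of distributions. No boundary conditions at $x=0$ are prescribed. Since $u_t=u_{xxx}+u_{xx}$, such a $u$ lies in $H^1(0,T;H^{-3}(\mathbb{R}^+))\subset C([0,T];H^{-3}(\mathbb{R}^+))$, and the values $u(\cdot,0)$, $u(\cdot,T)$ are understood in this sense. *)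

(* Defs.v *)
From HB Require Import structures.
From mathcomp Require Import all_boot all_order all_algebra.
From mathcomp Require Import all_classical all_reals all_analysis.
From mathcomp Require Import ess_sup_inf hoelder.

Set Implicit Arguments.
Unset Strict Implicit.
Unset Printing Implicit Defensive.

Import Order.TTheory GRing.Theory Num.Theory.
Import numFieldNormedType.Exports.

Local Open Scope classical_set_scope.
Local Open Scope ring_scope.

Section Distributions.
Context {R : realType} {V : normedModType R}.
Implicit Types (Omega : set V) (f g : V -> R) (D E : (V -> R) -> R).

(* Since 'D_v f is linear in v at points of differentiability, on a
   finite-dimensional V this is the usual notion of C^oo function. *)
Definition smooth f : Prop :=
  forall (s : seq V) (x : V), differentiable (foldr (fun v g => 'D_v g) f s) x.

(* C_c^oo(Omega), each function being extended by 0 outside Omega. *)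
Definition test_function Omega f : Prop :=
  [/\ smooth f,
      compact (closure [set x | f x != 0])
    & closure [set x | f x != 0] `<=` Omega].

(* A distribution on Omega is represented by a functional on V -> R of which
   only the values on the test functions of Omega are relevant. *)
Definition distr_eq Omega D E : Prop :=
  forall f, test_function Omega f -> D f = E f.

Definition distr_derive (v : V) D : (V -> R) -> R := fun f => - D ('D_v f).

Definition linear_on_test_functions Omega D : Prop :=
  forall (a : R) f g, test_function Omega f -> test_function Omega g ->
    D (fun x => a * f x + g x) = a * D f + D g.

End Distributions.

Section Spaces.
Context {R : realType}.

Definition lebesgue_on (I : interval R) : {measure set _ -> \bar R} :=
  mrestr (@lebesgue_measure R) (measurable_itv I).

Definition half_line : interval R := `]0, +oo[.

Definition time_interval (T : R) : interval R := `]0, T[.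

Definition norm_L2 (f : R -> R) : \bar R :=
  'N[lebesgue_on half_line]_2%:E[EFin \o f].

Definition L2 (f : R -> R) : Prop := f \in Lfun (lebesgue_on half_line) 2%:E.

Definition distr_of_L2 (f : R -> R) : (R -> R) -> R :=
  fun phi => \int[lebesgue_on half_line]_x (f x * phi x).

(* Below, u t is (a representative of) the function u(., t). *)

Definition simple_L2 (s : R -> R -> R) : Prop :=
  [/\ forall t, L2 (s t),
      finite_set (range s)
    & forall f, measurable (s @^-1` [set f])].

Definition strongly_measurable_L2 (T : R) (u : R -> R -> R) : Prop :=
  exists2 s : nat -> R -> R -> R, forall n, simple_L2 (s n) &
    \forall t \ae lebesgue_on (time_interval T),
      norm_L2 (s n t \- u t) @[n --> \oo] --> 0%E.

(* The Bochner space L^oo(0, T; L^2(R^+)). *)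
Definition Loo_L2 (T : R) (u : R -> R -> R) : Prop :=
  [/\ \forall t \ae lebesgue_on (time_interval T), L2 (u t),
      strongly_measurable_L2 T u
    & (ess_sup (lebesgue_on (time_interval T))
         (fun t => norm_L2 (u t)) < +oo)%E].

(* Points of the space-time domain are written (x, t). *)
Definition space_time (T : R) : set (R * R) :=
  [set` half_line] `*` [set` time_interval T].

Definition distr_of_Loo_L2 (T : R) (u : R -> R -> R) : (R * R -> R) -> R :=
  fun phi => \int[lebesgue_on (time_interval T)]_t
               \int[lebesgue_on half_line]_x (u t x * phi (x, t)).

Definition d_x : ((R * R -> R) -> R) -> (R * R -> R) -> R :=
  distr_derive ((1, 0) : R * R).

Definition d_t : ((R * R -> R) -> R) -> (R * R -> R) -> R :=
  distr_derive ((0, 1) : R * R).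

Definition norm_H3 (phi : R -> R) : R :=
  Num.sqrt (\sum_(k < 4) \int[lebesgue_on half_line]_x (derive1n k phi x ^+ 2)).

(* H^{-3}(R^+) is the dual of H^3_0(R^+), the closure of C_c^oo(R^+) in
   H^3(R^+); by density, its elements are the distributions on R^+ that are
   bounded for the H^3 norm, with the dual norm computed on C_c^oo(R^+). *)
Definition norm_Hm3 (L : (R -> R) -> R) : \bar R :=
  ereal_sup [set (`|L phi|)%:E | phi in
    [set phi | test_function [set` half_line] phi /\ norm_H3 phi <= 1]].

Definition Hm3 (L : (R -> R) -> R) : Prop :=
  linear_on_test_functions [set` half_line] L /\ (norm_Hm3 L < +oo)%E.

(* U is the representative of u in C([0, T]; H^{-3}(R^+)). The condition on
   almost every t determines U t on [0, T], by continuity, so that U 0 and U T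
   are the values u(., 0) and u(., T). *)
Definition continuous_representative (T : R) (u : R -> R -> R)
    (U : R -> (R -> R) -> R) : Prop :=
  [/\ forall t, t \in `[0, T] -> Hm3 (U t),
      forall t, t \in `[0, T] ->
        norm_Hm3 (U s \- U t) @[s --> within [set` `[0, T]] (nbhs t)] --> 0%E
    & \forall t \ae lebesgue_on (time_interval T),
        distr_eq [set` half_line] (U t) (distr_of_L2 (u t))].

End Spaces.

(* Main.v *)
Require Import Defs.
From mathcomp Require Import all_boot all_order all_algebra.
From mathcomp Require Import all_classical all_reals all_analysis.
From mathcomp Require Import ess_sup_inf hoelder measurable_realfun ring lra.

Import Order.TTheory GRing.Theory Num.Theory.
Import numFieldNormedType.Exports.

Local Open Scope classical_set_scope.
Local Open Scope ring_scope.

(** Rewritten as [u_t = (u_xx + u_x)_x], the equation is a conservation law: the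
    mass of [u] far from the boundary [x = 0] changes only through fluxes, and
    the flux, once averaged over a window of length one, is controlled by the
    [L^oo(0, T; L^2)] norm of [u]. Hence a datum of infinite mass cannot be
    steered to [0] in finite time, whatever happens at [x = 0]. The datum
    chosen here is [1 / (1 + |x|)] ([slow_decay]), which is square-integrable
    but not integrable at infinity.

    Let [phi] be the plateau function that is [1] on [[2, r]] and falls to [0]
    on each side over a window of length [1]. Its edges are translates of one
    smooth step, so [phi''] and [phi'''] live on the two windows and are
    bounded there by constants that do not depend on [r]
    ([plateau_pairing_bound]). Testing the equation against a product
    [phi(x) theta(t)] gives the weak form of
    [d/dt <u, phi> = <u, phi'' - phi'''>] ([tested_pairings]), and taking for
    [theta] a plateau that exhausts [(0, T)] turns it into a bound on
    [<u(0), phi> - <u(T), phi>] that is uniform in [r] ([end_values_bound]).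
    If [u(T) = 0], then [<u(0), phi>] stays bounded, whereas it is at least
    [ln (1 + r) - ln 3] ([slow_decay_mass]).

    The functions [t |-> <u(t), f>] are known only to coincide almost
    everywhere with the continuous functions [t |-> U t f]; Lebesgue integrals
    do not see the difference, even when the former are not Borel measurable
    ([ae_eq_integral_nomeas]). The end values are recovered from
    [theta'], which consists of a nonnegative kernel of mass one near [0] and
    the opposite of one near [T] ([plateau_end_values]). *)

(** * Smooth functions of one variable *)

Section SmoothFunctions.
Context {R : realType}.
Implicit Types (f g : R -> R) (n : nat) (x : R).

(** The recursion peels off one derivative at a time, so that the Leibniz and
    chain rules give the stability under products and composition by induction
    on [n]. *)
Fixpoint times_derivable n f : Prop :=
  if n is m.+1 then (forall x, derivable f x 1) /\ times_derivable m (derive1 f)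
  else True.

Definition infinitely_derivable f := forall n, times_derivable n f.

Lemma times_derivableW n f : times_derivable n.+1 f -> times_derivable n f.
Proof.
elim: n f => [//|n IHn] f [df /IHn df']; by split.
Qed.

Lemma derive1D f g : (forall x, derivable f x 1) ->
  (forall x, derivable g x 1) ->
  derive1 (fun x => f x + g x) = (fun x => derive1 f x + derive1 g x).
Proof. by move=> df dg; apply/funext => x; rewrite !derive1E deriveD. Qed.

Lemma derive1M f g : (forall x, derivable f x 1) ->
  (forall x, derivable g x 1) ->
  derive1 (fun x => f x * g x) = (fun x => f x * derive1 g x + g x * derive1 f x).
Proof. by move=> df dg; apply/funext => x; rewrite !derive1E deriveM. Qed.

Lemma times_derivableD n f g : times_derivable n f -> times_derivable n g ->
  times_derivable n (fun x => f x + g x).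
Proof.
elim: n f g => [//|n IHn] f g [df df'] [dg dg']; split.
  by move=> x; exact: derivableD.
by rewrite derive1D//; exact: IHn.
Qed.

Lemma times_derivableM n f g : times_derivable n f -> times_derivable n g ->
  times_derivable n (fun x => f x * g x).
Proof.
elim: n f g => [//|n IHn] f g df dg.
have [[df1 df'] [dg1 dg']] := (df, dg); split.
  by move=> x; exact: derivableM.
rewrite derive1M//; apply: times_derivableD; apply: IHn => //.
  exact: times_derivableW.
exact: times_derivableW.
Qed.

Lemma times_derivable_comp n f g : times_derivable n f ->
  times_derivable n g -> times_derivable n (fun x => f (g x)).
Proof.
elim: n f g => [//|n IHn] f g df dg.
have [[df1 df'] [dg1 dg']] := (df, dg); split.
  move=> x; apply/derivable1_diffP.
  by apply: (@differentiable_comp _ _ _ _ g f);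
    exact/derivable1_diffP.
have -> : derive1 (fun x => f (g x)) = (fun x => derive1 f (g x) * derive1 g x).
  by apply/funext => x; rewrite (@derive1_comp _ g f).
apply: times_derivableM => //; apply: IHn => //.
exact: times_derivableW.
Qed.

Lemma infinitely_derivable_cst (c : R) : infinitely_derivable (fun=> c).
Proof.
move=> n; elim: n c => [//|n IHn] c; split; first by move=> x; exact: derivable_cst.
have -> : derive1 (fun=> c) = (fun=> 0 : R) by apply/funext => x; rewrite derive1_cst.
exact: IHn.
Qed.

Lemma infinitely_derivable_id : infinitely_derivable (fun x => x).
Proof.
case=> [//|n]; split; first by move=> x; exact: derivable_id.
have -> : derive1 (fun x : R => x) = (fun=> 1 : R).
  by apply/funext => x; rewrite derive1_id.
exact: infinitely_derivable_cst.
Qed.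

Lemma infinitely_derivableD f g : infinitely_derivable f ->
  infinitely_derivable g -> infinitely_derivable (fun x => f x + g x).
Proof. by move=> df dg n; exact: times_derivableD. Qed.

Lemma infinitely_derivableM f g : infinitely_derivable f ->
  infinitely_derivable g -> infinitely_derivable (fun x => f x * g x).
Proof. by move=> df dg n; exact: times_derivableM. Qed.

Lemma infinitely_derivable_comp f g : infinitely_derivable f ->
  infinitely_derivable g -> infinitely_derivable (fun x => f (g x)).
Proof. by move=> df dg n; exact: times_derivable_comp. Qed.

Lemma infinitely_derivable_derivable f x :
  infinitely_derivable f -> derivable f x 1.
Proof. by move=> /(_ 1%N)[]. Qed.

Lemma infinitely_derivable_derive1 f :
  infinitely_derivable f -> infinitely_derivable (derive1 f).
Proof. by move=> df n; have [] := df n.+1. Qed.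

Lemma infinitely_derivable_derive1n n f :
  infinitely_derivable f -> infinitely_derivable (derive1n n f).
Proof.
move=> df; elim: n => [//|n IHn]; rewrite derive1nS.
exact: infinitely_derivable_derive1.
Qed.

Lemma infinitely_derivable_continuous f :
  infinitely_derivable f -> continuous f.
Proof.
move=> df x; apply: differentiable_continuous.
exact/derivable1_diffP/infinitely_derivable_derivable.
Qed.

(** For every [e > 0] the function [f x + e * x] is strictly increasing, hence
    has a nonnegative derivative, and [e] is arbitrary. *)
Lemma homo_derive1_ge0 f x : infinitely_derivable f ->
  {homo f : y z / y <= z} -> 0 <= derive1 f x.
Proof.
move=> df f_homo; apply/ler_addgt0Pr => e e0; rewrite -[e]mulr1.
have dfx y : derivable f y 1 by exact: infinitely_derivable_derivable.
have dex y : derivable (fun x : R => e * x) y 1.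
  by apply: derivableM; [exact: derivable_cst|exact: derivable_id].
have <- : derive1 (fun x : R => e * x) x = e * 1.
  by rewrite derive1E deriveMl// derive_id.
have -> : derive1 f x + derive1 (fun x : R => e * x) x =
    derive1 (fun x => f x + e * x) x by rewrite derive1D.
apply: (@incr_derive1_ge0 _ _ setT); last by rewrite interiorT.
- by move=> y _; exact: derivableD.
- by move=> y z _ _ yz; rewrite ler_ltD ?f_homo ?ltr_pM2l// ltW.
Qed.

Lemma derive1_eq0_out (a b c : R) f : (forall x, x < a -> f x = 0) ->
  (forall x, b < x -> f x = c) -> forall x, x \notin `[a, b] -> derive1 f x = 0.
Proof.
move=> fa fb x; rewrite in_itv/= negb_and -!ltNge => /orP[xa|bx].
  rewrite derive1E (@near_eq_derive _ _ _ _ (cst 0)) ?derive_cst//.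
  by near=> y; apply: fa; near: y; exact: lt_nbhsl.
rewrite derive1E (@near_eq_derive _ _ _ _ (cst c)) ?derive_cst//.
by near=> y; apply: fb; near: y; exact: lt_nbhsr.
Unshelve. all: by end_near. Qed.

Lemma derive1n_eq0_out (a b : R) f n : (forall x, x \notin `[a, b] -> f x = 0) ->
  forall x, x \notin `[a, b] -> derive1n n f x = 0.
Proof.
move=> fab; elim: n => [//|n IHn]; rewrite derive1nS.
apply: (@derive1_eq0_out a b 0) => x H; apply: IHn.
  by rewrite in_itv/= negb_and -!ltNge H.
by rewrite in_itv/= negb_and -!ltNge H orbT.
Qed.

Lemma bounded_of_continuous (a b : R) f : continuous f ->
  (forall x, x \notin `[a, b] -> f x = 0) ->
  exists2 C : R, 0 <= C & forall x, `|f x| <= C.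
Proof.
move=> cf fab.
have [M [Mreal HM]] : bounded_set (f @` `[a, b]).
  apply/compact_bounded/continuous_compact; last exact: segment_compact.
  exact: continuous_subspaceT.
exists (`|M| + 1); first by rewrite addr_ge0.
move=> x; have [xab|xab] := boolP (x \in `[a, b]); last first.
  by rewrite fab// normr0 addr_ge0.
apply: (HM (`|M| + 1)); last by exists x.
by rewrite (le_lt_trans (ler_norm _))// ltrDl.
Qed.

End SmoothFunctions.

(** * A smooth step *)

Section SmoothStep.
Context {R : realType}.
Implicit Types (P : {poly R}) (x y : R).

(** These are the functions [P(1/x) exp(-1/x)], extended by [0] on the left. The
    polynomial [P] makes the family stable under derivation. *)
Definition flat_fun P x : R :=
  if 0 < x then P.[x^-1] * expR (- x^-1) else 0.

Lemma exprn_le_expR n y : 0 <= y -> y ^+ n <= n`!%:R * expR y.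
Proof.
case: n => [|n] y0; first by rewrite expr0 mul1r (le_trans _ (expR_ge1Dx _))// lerDl.
rewrite mulrC -ler_pdivrMr ?ltr0n ?fact_gt0//.
by apply: le_trans (expR_ge1Dxn n y0); rewrite lerDr.
Qed.

Lemma horner_le_expR P :
  exists2 C : R, 0 <= C & forall y, 0 <= y -> `|P.[y]| <= C * expR y.
Proof.
exists (\sum_(i < size P) `|P`_i| * i`!%:R).
  by apply: sumr_ge0 => i _; exact: mulr_ge0.
move=> y y0; rewrite horner_coef (le_trans (ler_norm_sum _ _ _))//.
rewrite mulr_suml; apply: ler_sum => i _.
rewrite normrM -mulrA ler_wpM2l// ger0_norm ?exprn_ge0//.
exact: exprn_le_expR.
Qed.

(** With [y = 1/x], this is the domination of the polynomial [y^2 P(y)] by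
    [exp y]. It makes [flat_fun P] differentiable at [0], with derivative [0]. *)
Lemma flat_fun_quadratic P :
  exists2 C : R, 0 <= C & forall x, `|flat_fun P x| <= C * x ^+ 2.
Proof.
have [C C0 HC] := horner_le_expR (P * 'X^2); exists C => // x.
rewrite /flat_fun; case: ifPn => x0; last by rewrite normr0 mulr_ge0// sqr_ge0.
have := HC x^-1; rewrite invr_ge0 (ltW x0) => /(_ isT).
rewrite hornerM hornerXn exprVn normrM normfV [`|x ^+ 2|]ger0_norm ?sqr_ge0//.
rewrite ler_pdivrMr ?exprn_gt0// => H.
rewrite normrM [`|expR _|]gtr0_norm ?expR_gt0// expRN.
rewrite ler_pdivrMr ?expR_gt0//; apply: le_trans H _.
by rewrite mulrAC.
Qed.

Lemma is_derive_quadratic (f : R -> R) (C : R) : 0 <= C ->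
  (forall x, `|f x| <= C * x ^+ 2) -> is_derive (0 : R) (1 : R) f 0.
Proof.
move=> C0 fC.
have f0 : f 0 = 0.
  by apply/eqP; have := fC 0; rewrite expr0n mulr0 normr_le0.
suff h : h^-1 *: ((f \o shift 0) (h *: 1) - f 0) @[h --> (0 : R)^'] --> (0 : R).
  by apply: DeriveDef; [apply/cvg_ex; exists 0; exact: h|exact: cvg_lim h].
apply/cvgr0Pnorm_le => e e0; near=> h.
have h0 : 0 < `|h| by rewrite normr_gt0; near: h; exact: nbhs_dnbhs_neq.
rewrite /= f0 subr0 addr0 [_ *: 1]mulr1 normrM normfV ler_pdivrMl//.
apply: le_trans (fC h) _; rewrite -real_normK ?num_real// expr2 mulrA mulrC.
rewrite ler_pM2l//.
have : `|h| <= e / (C + 1).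
  near: h; apply: dnbhs0_le.
  by rewrite divr_gt0// ltr_wpDl.
rewrite ler_pdivlMr ?ltr_wpDl//; apply: le_trans.
by rewrite mulrC ler_wpM2l// lerDl.
Unshelve. all: by end_near. Qed.

Lemma is_derive_flat_fun P x :
  is_derive x (1 : R) (flat_fun P) (flat_fun ((P - P^`()) * 'X^2) x).
Proof.
have [x0|x0|->] := ltgtP x 0.
- rewrite {2}/flat_fun ltNge (ltW x0)/=.
  apply: (@near_eq_is_derive _ _ _ (cst 0)) => //.
    near=> y; rewrite /flat_fun ltNge ltW//=.
    by near: y; exact: lt_nbhsl.
- rewrite {2}/flat_fun x0.
  apply: (@near_eq_is_derive _ _ _ (fun y => P.[y^-1] * expR (- y^-1))).
    near=> y; rewrite /flat_fun ifT//.
    by near: y; exact: lt_nbhsr.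
  have xn0 : x != 0 by rewrite gt_eqF.
  have dV : is_derive x (1 : R) (fun y : R => y^-1) (- x ^- 2).
    by rewrite -[- _]mulr1; apply: is_deriveV.
  have dP : is_derive x (1 : R) (horner P \o (fun y : R => y^-1))
      (P^`().[x^-1] * - x ^- 2) by exact: is_derive1_comp.
  have dE : is_derive x (1 : R) (expR \o (fun y : R => - y^-1))
      (expR (- x^-1) * - - x ^- 2).
    by apply: is_derive1_comp; exact: (is_deriveN dV).
  apply: is_derive_eq (is_deriveM dP dE) _.
  rewrite /= !hornerE -exprVn /GRing.scale/=; ring.
- have [C C0 HC] := flat_fun_quadratic P.
  by rewrite {2}/flat_fun ltxx; exact: is_derive_quadratic HC.
Unshelve. all: by end_near. Qed.

Lemma infinitely_derivable_flat_fun P : infinitely_derivable (flat_fun P).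
Proof.
move=> n; elim: n P => [//|n IHn] P; split.
  by move=> x; have [] := is_derive_flat_fun P x.
have -> : derive1 (flat_fun P) = flat_fun ((P - P^`()) * 'X^2).
  by apply/funext => x; rewrite derive1E; have [_] := is_derive_flat_fun P x.
exact: IHn.
Qed.

(** Writing [e] for [flat_fun 1], the difference [e(1) - e(x)] is positive and
    constant for [x <= 0], and nonpositive for [1 <= x], where the outer [e]
    vanishes. Smoothness only needs composition, no quotient of functions. *)
Definition smooth_step x : R :=
  1 - flat_fun 1 (flat_fun 1 1 - flat_fun 1 x) / flat_fun 1 (flat_fun 1 1).

Let flat_fun1_gt0 x : 0 < x -> 0 < flat_fun 1 x.
Proof. by move=> x0; rewrite /flat_fun x0 hornerC mul1r expR_gt0. Qed.

Lemma smooth_step_le0 x : x <= 0 -> smooth_step x = 0.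
Proof.
move=> x0; rewrite /smooth_step [flat_fun 1 x]/flat_fun ltNge x0/= subr0.
by rewrite divff ?subrr// gt_eqF// !flat_fun1_gt0.
Qed.

Lemma smooth_step_ge1 x : 1 <= x -> smooth_step x = 1.
Proof.
move=> x1; rewrite /smooth_step [flat_fun 1 (_ - _)]/flat_fun ifF ?mul0r ?subr0//.
apply/negbTE; rewrite -leNgt subr_le0 /flat_fun ltr01 (lt_le_trans ltr01 x1).
by rewrite !hornerC !mul1r ler_expR lerN2 lef_pV2// posrE// (lt_le_trans ltr01).
Qed.

Lemma infinitely_derivable_smooth_step : infinitely_derivable smooth_step.
Proof.
have -> : smooth_step = (fun x => 1 + (- (flat_fun 1 (flat_fun 1 1))^-1) *
    flat_fun 1 (flat_fun 1 1 + (-1) * flat_fun 1 x)).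
  by apply/funext => x; rewrite /smooth_step mulN1r mulNr mulrC.
pose cstE := @infinitely_derivable_cst R.
apply: infinitely_derivableD => //; apply: infinitely_derivableM => //.
apply: infinitely_derivable_comp; first exact: infinitely_derivable_flat_fun.
apply: infinitely_derivableD => //; apply: infinitely_derivableM => //.
exact: infinitely_derivable_flat_fun.
Qed.

Let flat_fun1_homo : {homo (flat_fun 1) : x y / x <= y}.
Proof.
move=> x y xy; rewrite /flat_fun; case: ifPn => x0.
  by rewrite (lt_le_trans x0 xy) !hornerC !mul1r ler_expR lerN2 lef_pV2// posrE
    (lt_le_trans x0 xy).
by case: ifPn => // y0; rewrite hornerC mul1r expR_ge0.
Qed.

Lemma smooth_step_homo : {homo smooth_step : x y / x <= y}.
Proof.
move=> x y xy; rewrite /smooth_step lerD2l lerN2 ler_wpM2r//.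
  by rewrite invr_ge0 ltW// !flat_fun1_gt0.
by rewrite flat_fun1_homo// lerD2l lerN2 flat_fun1_homo.
Qed.

Lemma smooth_step_ge0 x : 0 <= smooth_step x.
Proof.
have [x0|/ltW x0] := leP x 0; first by rewrite smooth_step_le0.
by rewrite -(smooth_step_le0 0 (lexx _)) smooth_step_homo.
Qed.

Lemma smooth_step_le1 x : smooth_step x <= 1.
Proof.
have [x1|/ltW x1] := leP x 1; last by rewrite smooth_step_ge1.
by rewrite -(smooth_step_ge1 1 (lexx _)) smooth_step_homo.
Qed.

Lemma derive1_smooth_step_ge0 x : 0 <= derive1 smooth_step x.
Proof.
exact: homo_derive1_ge0 infinitely_derivable_smooth_step smooth_step_homo.
Qed.

End SmoothStep.

(** * Test functions *)

Section TestFunctions.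
Context {R : realType}.

(** Smoothness is coinductive: it suffices to exhibit a class of differentiable
    functions that is stable under directional derivatives. *)
Lemma smooth_of_closed (V : normedModType R) (P : (V -> R) -> Prop) :
  (forall f, P f -> forall x, differentiable f x) ->
  (forall f v, P f -> P ('D_v f)) -> forall f, P f -> smooth f.
Proof.
move=> Pd PD f Pf s; apply: Pd; elim: s => [//|v s IHs] /=.
exact: PD.
Qed.

Lemma derive_derive1 (f : R -> R) (v x : R) : derivable f x 1 ->
  'D_v f x = v * derive1 f x.
Proof.
move=> /derivable1_diffP df; rewrite derive1E !deriveE//.
by rewrite -{1}[v]mulr1 linearZ.
Qed.

Lemma infinitely_derivable_smooth (f : R -> R) :
  infinitely_derivable f -> smooth f.
Proof.
apply: smooth_of_closed.
  by move=> g dg x; apply/derivable1_diffP/infinitely_derivable_derivable.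
move=> g v dg.
have -> : 'D_v g = (fun x => v * derive1 g x).
  by apply/funext => x; rewrite derive_derive1//; exact: infinitely_derivable_derivable.
apply: infinitely_derivableM; first exact: infinitely_derivable_cst.
exact: infinitely_derivable_derive1.
Qed.

Lemma closure_support_sub (V : normedModType R) (K : set V) (f : V -> R) :
  closed K -> (forall x, ~ K x -> f x = 0) ->
  closure [set x | f x != 0] `<=` K.
Proof.
move=> cK fK; apply: subset_trans cK; apply: closure_subset => x /= fx0.
by apply: contrapT => /fK /eqP; rewrite (negbTE fx0).
Qed.

Lemma test_function_of_compact (V : normedModType R) (Omega K : set V)
    (f : V -> R) : smooth f -> compact K -> closed K -> K `<=` Omega ->
  (forall x, ~ K x -> f x = 0) -> test_function Omega f.
Proof.
move=> sf cptK cK KO fK; have H := closure_support_sub _ _ _ cK fK; split => //.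
  by apply: subclosed_compact H => //; exact: closed_closure.
exact: subset_trans KO.
Qed.

Lemma test_function_itv (Omega : set R) (a b : R) (f : R -> R) :
  infinitely_derivable f -> `[a, b] `<=` Omega ->
  (forall x, x \notin `[a, b] -> f x = 0) -> test_function Omega f.
Proof.
move=> df abO fab; apply: (@test_function_of_compact _ _ `[a, b]) => //.
- exact: infinitely_derivable_smooth.
- exact: segment_compact.
- exact: interval_closed.
- by move=> x /= /negP; exact: fab.
Qed.

(** A directional derivative of a product [f(x) g(t)] is a sum of two such
    products, whence the closure under sums. *)
Inductive tensor_sum : (R * R -> R) -> Prop :=
| TensorProd f g : infinitely_derivable f -> infinitely_derivable g ->
    tensor_sum (fun z => f z.1 * g z.2)
| TensorAdd F G : tensor_sum F -> tensor_sum G ->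
    tensor_sum (fun z => F z + G z).

Let differentiable_fst (z : R * R) : differentiable fst z.
Proof. by apply: linear_differentiable => y; exact: cvg_fst. Qed.

Let differentiable_snd (z : R * R) : differentiable snd z.
Proof. by apply: linear_differentiable => y; exact: cvg_snd. Qed.

Lemma is_derive_fst (f : R -> R) (v z : R * R) : derivable f z.1 1 ->
  is_derive z v (fun z => f z.1) (v.1 * derive1 f z.1).
Proof.
move=> /[dup] df' /derivable1_diffP df.
have d1 : differentiable (fun z : R * R => f z.1) z.
  exact: (@differentiable_comp _ _ _ _ fst f).
apply: DeriveDef; first exact: diff_derivable.
rewrite deriveE// (@diff_comp _ _ _ _ fst f)//= -derive_derive1// deriveE//.
by congr ('d f _ _); rewrite diff_lin//; move=> y; exact: cvg_fst.
Qed.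

Lemma is_derive_snd (f : R -> R) (v z : R * R) : derivable f z.2 1 ->
  is_derive z v (fun z => f z.2) (v.2 * derive1 f z.2).
Proof.
move=> /[dup] df' /derivable1_diffP df.
have d1 : differentiable (fun z : R * R => f z.2) z.
  exact: (@differentiable_comp _ _ _ _ snd f).
apply: DeriveDef; first exact: diff_derivable.
rewrite deriveE// (@diff_comp _ _ _ _ snd f)//= -derive_derive1// deriveE//.
by congr ('d f _ _); rewrite diff_lin//; move=> y; exact: cvg_snd.
Qed.

Lemma derive_tensor (f g : R -> R) (v : R * R) :
  infinitely_derivable f -> infinitely_derivable g ->
  'D_v (fun z => f z.1 * g z.2) =
  (fun z => (v.1 * derive1 f z.1) * g z.2 + f z.1 * (v.2 * derive1 g z.2)).
Proof.
move=> df dg; apply/funext => z.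
have Df := is_derive_fst f v z (infinitely_derivable_derivable f z.1 df).
have Dg := is_derive_snd g v z (infinitely_derivable_derivable g z.2 dg).
have [_ ->] := is_deriveM Df Dg.
by rewrite /GRing.scale/= addrC [g _ * _]mulrC.
Qed.

Lemma differentiable_tensor_sum F z : tensor_sum F -> differentiable F z.
Proof.
elim=> [f g df dg|{}F G _ dF _ dG]; last exact: differentiableD.
apply: differentiableM.
  apply: (@differentiable_comp _ _ _ _ fst f) => //.
  exact/derivable1_diffP/infinitely_derivable_derivable.
apply: (@differentiable_comp _ _ _ _ snd g) => //.
exact/derivable1_diffP/infinitely_derivable_derivable.
Qed.

Lemma tensor_sum_derive F v : tensor_sum F -> tensor_sum ('D_v F).
Proof.
elim=> [f g df dg|{}F G tF IHF tG IHG].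
  have dM (c : R) (h : R -> R) : infinitely_derivable h ->
      infinitely_derivable (fun x => c * derive1 h x).
    move=> dh; apply: infinitely_derivableM; first exact: infinitely_derivable_cst.
    exact: infinitely_derivable_derive1.
  rewrite derive_tensor//; apply: TensorAdd.
    exact: (TensorProd (fun x => v.1 * derive1 f x) g (dM _ _ df) dg).
  exact: (TensorProd f (fun x => v.2 * derive1 g x) df (dM _ _ dg)).
have -> : 'D_v (fun z => F z + G z) = (fun z => 'D_v F z + 'D_v G z).
  by apply/funext => z; rewrite (@deriveD _ _ _ F G)//;
    exact/diff_derivable/differentiable_tensor_sum.
exact: TensorAdd.
Qed.

Lemma tensor_sum_smooth F : tensor_sum F -> smooth F.
Proof.
move: F; apply: smooth_of_closed => [F tF z|F v].
  exact: differentiable_tensor_sum.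
exact: tensor_sum_derive.
Qed.

Lemma test_function_tensor (T a b c d : R) (f g : R -> R) :
  infinitely_derivable f -> infinitely_derivable g ->
  (forall x, x \notin `[a, b] -> f x = 0) ->
  (forall t, t \notin `[c, d] -> g t = 0) ->
  0 < a -> 0 < c -> d < T ->
  test_function (space_time T) (fun z => f z.1 * g z.2).
Proof.
move=> df dg fab gcd a0 c0 dT.
apply: (@test_function_of_compact _ _ (`[a, b] `*` `[c, d])) => //.
- exact/tensor_sum_smooth/TensorProd.
- by apply: compact_setX; exact: segment_compact.
- apply: compact_closed; first exact: norm_hausdorff.
  by apply: compact_setX; exact: segment_compact.
- move=> [x t] [/=]; rewrite !in_itv/= => /andP[ax _] /andP[ct td].
  split => /=; rewrite in_itv/= ?andbT; first exact: lt_le_trans ax.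
  by rewrite (lt_le_trans c0 ct) (le_lt_trans td dT).
- move=> [x t] /=.
  have [xab|/fab ->] := boolP (x \in `[a, b]); last by rewrite mul0r.
  have [tcd|/gcd ->] := boolP (t \in `[c, d]); last by rewrite mulr0.
  by move=> H; exfalso; exact: H.
Qed.

Lemma derive_tensor_x (f g : R -> R) :
  infinitely_derivable f -> infinitely_derivable g ->
  'D_((1, 0) : R * R) (fun z => f z.1 * g z.2) =
  (fun z => derive1 f z.1 * g z.2).
Proof.
move=> df dg; rewrite derive_tensor//; apply/funext => z /=.
by rewrite mul1r mul0r mulr0 addr0.
Qed.

Lemma derive_tensor_t (f g : R -> R) :
  infinitely_derivable f -> infinitely_derivable g ->
  'D_((0, 1) : R * R) (fun z => f z.1 * g z.2) =
  (fun z => f z.1 * derive1 g z.2).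
Proof.
move=> df dg; rewrite derive_tensor//; apply/funext => z /=.
by rewrite mul1r mul0r mul0r add0r.
Qed.

End TestFunctions.

(** * Integrals of functions that may fail to be measurable *)

Section IntegralsWithoutMeasurability.
Context d (T : measurableType d) (R : realType).
Variable mu : {measure set T -> \bar R}.
Local Open Scope ereal_scope.
Implicit Types (f g : T -> \bar R) (D : set T).
Import HBNNSimple.

(** The integral of a nonnegative function is the supremum of the integrals of
    the simple functions below it. Cutting a simple function off on a null set
    does not change its integral, so an inequality that fails on a null set
    only is still inherited by the suprema. *)
Lemma ge0_ae_le_integral_nomeas f g :
  (forall x, 0 <= f x) -> (forall x, 0 <= g x) ->
  (\forall x \ae mu, f x <= g x) -> \int[mu]_x f x <= \int[mu]_x g x.
Proof.
move=> f0 g0 [N [mN muN0 Nfg]].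
rewrite !ge0_integralTE//; apply: ge_ereal_sup => _ [h /= hf <-].
have mNC : measurable (~` N) by exact: measurableC.
apply: le_ereal_sup_tmp; exists (sintegral mu (proj_nnsfun h mNC)).
  exists (proj_nnsfun h mNC) => //= x; rewrite mindicE.
  have [xN|xN] := boolP (x \in ~` N); last by rewrite mulr0.
  rewrite mulr1; apply: le_trans (hf x) _; apply: contrapT => /Nfg.
  by rewrite inE in xN.
rewrite -!integralT_nnsfun le_eqVlt; apply/orP; left; apply/eqP.
apply: ae_eq_integral => //.
- exact/measurable_EFinP.
- exact/measurable_EFinP.
- exists N; split => // x /=; apply: contra_notP => xN _.
  by rewrite mindicE mem_set// mulr1.
Qed.

Lemma ae_eq_integral_nomeas f g : (\forall x \ae mu, f x = g x) ->
  \int[mu]_x f x = \int[mu]_x g x.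
Proof.
move=> fg; rewrite integralE [RHS]integralE; congr (_ - _);
  apply/eqP; rewrite eq_le; apply/andP; split;
  apply: ge0_ae_le_integral_nomeas => //; by apply: filterS fg => x;
  rewrite ?funeposE ?funenegE => ->.
Qed.

Lemma sintegral_mrestr D (mD : measurable D) (h : {nnsfun T >-> R}) :
  sintegral (mrestr mu mD) h = sintegral mu (proj_nnsfun h mD).
Proof.
rewrite !sintegralET; apply: eq_fsbigr => x _.
have [->|x0] := eqVneq x 0%R; first by rewrite !mul0e.
congr (_ * _); rewrite /= /mrestr; congr (mu _).
apply/seteqP; split => y /=.
  by move=> [<- Dy]; rewrite mindicE mem_set// mulr1.
rewrite mindicE; have [yD|yD] := boolP (y \in D).
  by rewrite mulr1 => ->; rewrite inE in yD.
by rewrite mulr0 => /esym/eqP; rewrite (negbTE x0).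
Qed.

(** Again by comparing simple functions: those below [f] on [D] and [0] elsewhere
    are those below [f], cut off outside [D]. *)
Lemma integral_mrestr D (mD : measurable D) f :
  \int[mrestr mu mD]_x f x = \int[mu]_(x in D) f x.
Proof.
suff ge0E g : (forall x, 0 <= g x) ->
    \int[mrestr mu mD]_x g x = \int[mu]_(x in D) g x.
  by rewrite [LHS]integralE [RHS]integralE !ge0E.
move=> g0; rewrite ge0_integralTE// ge0_integralE//.
apply/eqP; rewrite eq_le; apply/andP; split;
  apply: ge_ereal_sup => _ [h /= hg <-]; apply: ereal_sup_ubound => /=.
- exists (proj_nnsfun h mD); last by rewrite sintegral_mrestr.
  move=> x /=; rewrite mindicE patchE; case: ifPn => _.
    by rewrite mulr1.
  by rewrite mulr0.
- exists h => [x|].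
    by apply: le_trans (hg x) _; rewrite patchE; case: ifPn.
  rewrite sintegral_mrestr; apply: eq_sintegral => x /=; rewrite mindicE.
  have := hg x; rewrite patchE; case: ifPn => _; first by rewrite mulr1.
  by rewrite mulr0 lee_fin => hx; apply/eqP; rewrite eq_le hx fun_ge0.
Qed.

End IntegralsWithoutMeasurability.

Lemma Rintegral_lebesgue_on {R : realType} (I : interval R) (f : R -> R) :
  \int[lebesgue_on I]_x f x = \int[lebesgue_measure]_(x in [set` I]) f x.
Proof. by rewrite /Rintegral integral_mrestr. Qed.

#[local] Instance ae_filter_lebesgue_on {R : realType} (I : interval R) :
  Filter (almost_everywhere (lebesgue_on I)).
Proof. exact: ae_filter_ringOfSetsType. Qed.

#[local] Instance nbhs_ae_filter_lebesgue_on {R : realType} (I : interval R) :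
  Filter (nbhs (almost_everywhere (lebesgue_on I))).
Proof. exact: ae_filter_lebesgue_on. Qed.

Lemma ae_eq_Rintegral_lebesgue_on {R : realType} (I : interval R) (f g : R -> R) :
  (\forall x \ae lebesgue_on I, f x = g x) ->
  \int[lebesgue_on I]_x f x = \int[lebesgue_on I]_x g x.
Proof.
move=> fg; congr fine; apply: ae_eq_integral_nomeas.
by apply: filterS fg => x ->.
Qed.

Lemma ae_lebesgue_onP {R : realType} (I : interval R) (P : R -> Prop) :
  (\forall x \ae lebesgue_on I, P x) <->
  {ae lebesgue_measure, forall x, [set` I] x -> P x}.
Proof.
split=> [[N [mN N0 PN]]|[N [mN N0 PN]]].
  exists (N `&` [set` I]); split => //.
    exact: measurableI.
  by move=> x /= /not_implyP[xI Px]; split => //; exact: PN.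
exists (N `|` ~` [set` I]); split.
- by apply: measurableU => //; exact: measurableC.
- rewrite /= /mrestr setIUl setICl setU0.
  by apply: (subset_measure0 _ mN (@subIsetl _ _ _)) => //; exact: measurableI.
- move=> x /= Px; have [xI|xI] := boolP (x \in I); last by right; exact/negP.
  by left; apply: PN => /= /(_ xI).
Qed.

(** * Square-integrable functions on the half-line *)

Section SquareIntegrable.
Context {R : realType}.
Implicit Types (f g : R -> R) (I : interval R).

Lemma integrable_lebesgue_on I f : measurable_fun setT f ->
  (lebesgue_on I).-integrable setT (EFin \o f) <->
  lebesgue_measure.-integrable [set` I] (EFin \o f).
Proof.
move=> mf; split => /integrableP[_ intf]; apply/integrableP; split.
- by apply/measurable_EFinP; apply: measurable_funS mf.
- by move: intf; rewrite integral_mrestr.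
- exact/measurable_EFinP.
- by rewrite integral_mrestr.
Qed.

Lemma integrable_of_supported I (a b : R) f : continuous f ->
  (forall x, x \notin `[a, b] -> f x = 0) ->
  (lebesgue_on I).-integrable setT (EFin \o f).
Proof.
move=> cf fab; have mf : measurable_fun setT f by exact: continuous_measurable_fun.
apply/integrable_lebesgue_on => //; apply: (@integrableS _ _ _ _ setT) => //.
have -> : EFin \o f = (EFin \o f) \_ `[a, b].
  apply/funext => x; rewrite patchE /=; case: ifPn => //.
  by rewrite notin_setE => /= /negP xab; rewrite fab.
have iab : lebesgue_measure.-integrable `[a, b] (EFin \o f).
  apply: continuous_compact_integrable; first exact: segment_compact.
  exact: continuous_subspaceT.
have := (@integrable_mkcond _ _ _ lebesgue_measure `[a, b] (EFin \o f)
  (measurable_itv _)).1 iab.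
exact.
Qed.

Lemma powR2 (x : R) : `|x| `^ 2 = x ^+ 2.
Proof. by rewrite powR_mulrn// real_normK// num_real. Qed.

Lemma norm_L2E f :
  (norm_L2 f `^ 2 = \int[lebesgue_on half_line]_x (f x ^+ 2)%:E)%E.
Proof.
rewrite /norm_L2 poweR_Lnorm ?pnatr_eq0//.
by apply: eq_integral => x _ /=; rewrite powR2.
Qed.

Lemma L2P f : L2 f <->
  measurable_fun setT f /\
  (lebesgue_on half_line).-integrable setT (fun x => (f x ^+ 2)%:E).
Proof.
split=> [f2|[mf /integrableP[_ intf]]].
  split; last exact: (Lfun2_integrable_sqr f2).
  by move: f2 => /andP[]; rewrite inE.
rewrite /L2 inE; apply/andP; split; first by rewrite inE.
rewrite inE /= /finite_norm.
have : (norm_L2 f `^ 2 < +oo)%E.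
  rewrite norm_L2E; apply: le_lt_trans intf.
  by under [leRHS]eq_integral do rewrite gee0_abs ?lee_fin ?sqr_ge0//.
rewrite /norm_L2; case: Lnorm (Lnorm_ge0 (lebesgue_on half_line) 2%:E (EFin \o f)).
- by move=> r _ _; exact: ltry.
- by move=> _ /=; rewrite pnatr_eq0.
- by [].
Qed.

Lemma L2_of_supported (a b : R) f : continuous f ->
  (forall x, x \notin `[a, b] -> f x = 0) -> L2 f.
Proof.
move=> cf fab; apply/L2P; split; first exact: continuous_measurable_fun.
apply: (@integrable_of_supported _ a b (fun x => f x ^+ 2)).
  by move=> x; apply: (@continuous_comp _ _ _ f (fun y => y ^+ 2));
    [exact: cf|exact: exprn_continuous].
by move=> x /fab ->; rewrite expr0n.
Qed.

Lemma L2_mul_integrable f g : L2 f -> L2 g ->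
  (lebesgue_on half_line).-integrable setT (fun x => (f x * g x)%:E).
Proof. by move=> f2 g2; apply/Lfun1_integrable; exact: Lfun2_mul_Lfun1. Qed.

(** The crude form of the Cauchy-Schwarz inequality given by
    [|p q| <= p^2 + q^2]; only the finiteness of the bound matters. *)
Lemma Rintegral_L2_mul_le f g : L2 f -> L2 g ->
  `|\int[lebesgue_on half_line]_x (f x * g x)| <=
  \int[lebesgue_on half_line]_x (f x ^+ 2) +
  \int[lebesgue_on half_line]_x (g x ^+ 2).
Proof.
move=> f2 g2; have [_ if2] := (L2P f).1 f2; have [_ ig2] := (L2P g).1 g2.
have ifg := L2_mul_integrable f g f2 g2.
apply: le_trans (le_normr_Rintegral _ ifg) _ => //.
rewrite -RintegralD//; apply: le_Rintegral => //.
- by have := integrable_norm ifg.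
- by have := integrableD measurableT if2 ig2.
move=> x _; rewrite normrM -[f x ^+ 2]real_normK ?num_real//.
rewrite -[g x ^+ 2]real_normK ?num_real//.
have := normr_ge0 (f x); have := normr_ge0 (g x).
move: `|f x| `|g x| => p q; nra.
Qed.

Lemma Rintegral_sqr_le (C a b : R) g : a <= b -> continuous g ->
  (forall x, x \notin `[a, b] -> g x = 0) -> (forall x, `|g x| <= C) ->
  \int[lebesgue_on half_line]_x (g x ^+ 2) <= C ^+ 2 * (b - a).
Proof.
move=> ab cg gab gC; have [mg ig] := (L2P g).1 (L2_of_supported a b g cg gab).
rewrite -lee_fin fineK; last exact: integrable_fin_num ig.
have mab : measurable (`[a, b] : set R) by exact: measurable_itv.
apply: (@le_trans _ _
    (\int[lebesgue_on half_line]_x ((C ^+ 2)%:E * (\1_(`[a, b]) x)%:E))%E).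
  apply: ge0_le_integral => //.
  - by move=> x _; rewrite lee_fin sqr_ge0.
  - by case/integrableP : ig.
  - by apply/measurable_EFinP; apply: measurable_funM => //.
  move=> x _; rewrite -EFinM lee_fin indicE.
  have [xab|] := boolP (x \in `[a, b]).
    by rewrite mem_set//= mulr1 -real_normK ?num_real// lerXn2r ?nnegrE ?(le_trans _ (gC x)).
  by move=> /gab ->; rewrite expr0n mulr_ge0// sqr_ge0.
rewrite ge0_integralZl//; last by rewrite lee_fin sqr_ge0.
rewrite (EFinM (C ^+ 2)) lee_wpmul2l ?lee_fin ?sqr_ge0// integral_indic//=.
rewrite setIT /mrestr; apply: (@le_trans _ _ (lebesgue_measure `[a, b]%classic)).
  by apply: le_measure; rewrite ?inE//; apply: measurableI.
by rewrite lebesgue_measure_itv/= lte_fin; case: ltP; rewrite ?lee_fin ?subr_ge0.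
by apply/measurable_EFinP; exact: measurable_indic.
Qed.

Lemma Loo_L2_bound (T : R) (u : R -> R -> R) : Loo_L2 T u ->
  exists M : R, \forall t \ae lebesgue_on (time_interval T),
    L2 (u t) /\ \int[lebesgue_on half_line]_x (u t x ^+ 2) <= M.
Proof.
move=> [uL2 _]; set s := ess_sup _ _ => s_fin.
have us := ess_sup_ge (lebesgue_on (time_interval T)) (fun t => norm_L2 (u t)).
rewrite -[ess_sup _ _]/s in us; move: s s_fin us => s s_fin us.
exists (fine s ^+ 2); apply: filterS2 uL2 us => t ut2 uts; split => //.
rewrite /Rintegral -norm_L2E -lee_fin.
have := Lnorm_ge0 (lebesgue_on half_line) 2%:E (EFin \o u t).
rewrite -/(norm_L2 (u t)).
case: (norm_L2 (u t)) uts => [r||//]; case: s s_fin => [s'||]//= _ rs r0.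
rewrite !lee_fin in rs r0 *.
by rewrite powR_mulrn// lerXn2r// nnegrE (le_trans r0).
Qed.

End SquareIntegrable.

(** * Continuity in time of the duality pairings *)

Section ContinuityInTime.
Context {R : realType}.
Implicit Types (f : R -> R) (L : (R -> R) -> R).

Lemma derive1nZ n (c : R) f : infinitely_derivable f ->
  derive1n n (fun x => c * f x) = (fun x => c * derive1n n f x).
Proof.
move=> df; elim: n => [//|n IHn]; rewrite !derive1nS IHn.
apply/funext => x; rewrite !derive1E deriveMl//.
exact/infinitely_derivable_derivable/infinitely_derivable_derive1n.
Qed.

Lemma norm_H3_scale (a b c : R) f : infinitely_derivable f ->
  (forall x, x \notin `[a, b] -> f x = 0) -> 0 <= c ->
  norm_H3 (fun x => c * f x) = c * norm_H3 f.
Proof.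
move=> df fab c0; rewrite /norm_H3.
have -> : \sum_(k < 4) \int[lebesgue_on half_line]_x
    (derive1n k (fun x => c * f x) x ^+ 2) = c ^+ 2 * \sum_(k < 4)
    \int[lebesgue_on half_line]_x (derive1n k f x ^+ 2).
  rewrite mulr_sumr; apply: eq_bigr => k _; rewrite derive1nZ//.
  have cd := infinitely_derivable_continuous _
    (infinitely_derivable_derive1n k f df).
  have [_ ik] := (L2P _).1 (L2_of_supported a b _ cd (derive1n_eq0_out a b f k fab)).
  by rewrite -RintegralZl//; apply: eq_Rintegral => x _; rewrite exprMn.
by rewrite sqrtrM ?sqr_ge0// sqrtr_sqr ger0_norm.
Qed.

(** The dual norm is a supremum over the unit ball, so [f] is first divided by
    [norm_H3 f + 1], which is positive even if [norm_H3 f = 0]. *)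
Lemma norm_Hm3_bound (a b e : R) f L : infinitely_derivable f ->
  (forall x, x \notin `[a, b] -> f x = 0) -> 0 < a ->
  linear_on_test_functions [set` half_line] L ->
  (norm_Hm3 L <= e%:E)%E -> `|L f| <= e * (norm_H3 f + 1).
Proof.
move=> df fab a0 linL Le.
have abO : `[a, b]%classic `<=` [set` @half_line R].
  by move=> x /=; rewrite !in_itv/= andbT => /andP[+ _]; exact: lt_le_trans.
have tf : test_function [set` half_line] f by exact: test_function_itv fab.
have t0 : test_function [set` half_line] (fun=> 0 : R).
  by apply: (test_function_itv _ a b) => //; exact: infinitely_derivable_cst.
have L0 : L (fun=> 0) = 0.
  have := linL 1 _ _ t0 t0; rewrite !mul1r addr0.
  by move=> /eqP; rewrite -subr_eq subrr => /eqP.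
set N := norm_H3 f + 1; have N0 : 0 < N by rewrite ltr_wpDl// sqrtr_ge0.
pose g x := N^-1 * f x.
have dg : infinitely_derivable g.
  by apply: infinitely_derivableM => //; exact: infinitely_derivable_cst.
have tg : test_function [set` half_line] g.
  by apply: (test_function_itv _ a b) => // x /fab fx; rewrite /g fx mulr0.
have Lg : L g = N^-1 * L f.
  rewrite -[RHS]addr0 -L0 -(linL _ _ _ tf t0); congr (L _).
  by apply/funext => x; rewrite addr0.
have : `|L g| <= e.
  rewrite -lee_fin; apply: le_trans Le; apply: ereal_sup_ubound.
  exists g => //; split => //.
  rewrite (norm_H3_scale a b)// ?invr_ge0 ?(ltW N0)//.
  by rewrite ler_pdivrMl// mulr1 lerDl.
by rewrite Lg normrM gtr0_norm ?invr_gt0// ler_pdivrMl// mulrC.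
Qed.

Lemma linear_on_test_functionsB (Omega : set R) L L' :
  linear_on_test_functions Omega L -> linear_on_test_functions Omega L' ->
  linear_on_test_functions Omega (L \- L').
Proof.
move=> linL linL' c f g tf tg /=; rewrite linL// linL'//; ring.
Qed.

Lemma continuous_representative_pairing (T : R) u (U : R -> (R -> R) -> R)
    (a b : R) f : infinitely_derivable f ->
  (forall x, x \notin `[a, b] -> f x = 0) -> 0 < a ->
  continuous_representative T u U ->
  {within `[0, T], continuous (fun t => U t f)}.
Proof.
move=> df fab a0 [UH Uc _]; apply/subspace_continuousP => t tT.
have N0 : 0 < norm_H3 f + 1 by rewrite ltr_wpDl// sqrtr_ge0.
apply/cvgrPdist_le => e e0.
have /(Uc t tT) /= near_t :
    nbhs 0%E [set y | (y < (e / (norm_H3 f + 1))%:E)%E].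
  apply: open_nbhs_nbhs; split; first exact: open_ereal_lt_ereal.
  by rewrite /= lte_fin divr_gt0.
near=> s; have sT : s \in `[0, T] by near: s; exact: withinT.
rewrite distrC -[leRHS](divfK (lt0r_neq0 N0)).
apply: (@norm_Hm3_bound a b _ f (U s \- U t)) => //.
  by apply: linear_on_test_functionsB; [have [] := UH s sT|have [] := UH t tT].
by apply: ltW; near: s; exact: near_t.
Unshelve. all: by end_near. Qed.

End ContinuityInTime.

(** * Plateau functions *)

Section Plateau.
Context {R : realType}.
Implicit Types (a b h x : R) (g : R -> R).

Lemma infinitely_derivable_affine g a h : infinitely_derivable g ->
  infinitely_derivable (fun x => g ((x - a) / h)).
Proof.
move=> dg; apply: infinitely_derivable_comp => //.
apply: infinitely_derivableM; last exact: infinitely_derivable_cst.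
apply: infinitely_derivableD; first exact: infinitely_derivable_id.
exact: infinitely_derivable_cst.
Qed.

Lemma derive1_affine g a h : infinitely_derivable g ->
  derive1 (fun x => g ((x - a) / h)) = (fun x => h^-1 * derive1 g ((x - a) / h)).
Proof.
move=> dg; apply/funext => x.
have Dl : is_derive x (1 : R) (fun x => (x - a) / h) h^-1.
  have Ds : is_derive x (1 : R) (fun x => x - a) 1.
    by rewrite -[X in is_derive _ _ _ X](subr0 1); apply: is_deriveB.
  apply: is_derive_eq (is_deriveM Ds (is_derive_cst h^-1 x (1 : R))) _.
  by rewrite scaler0 add0r [_ *: 1]mulr1.
have Dg : is_derive ((x - a) / h) (1 : R) g (derive1 g ((x - a) / h)).
  by apply: DeriveDef; [exact: infinitely_derivable_derivable|rewrite derive1E].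
have [_] := @is_derive1_comp _ g (fun x => (x - a) / h) x _ _ Dg Dl.
by move=> DE; rewrite mulrC -DE derive1E.
Qed.

(** Rises from [0] to [1] on [[a, a + h]] and falls back on [[b, b + h]]. *)
Definition plateau h a b x : R :=
  smooth_step ((x - a) / h) - smooth_step ((x - b) / h).

Lemma infinitely_derivable_plateau h a b : infinitely_derivable (plateau h a b).
Proof.
have dS (c : R) := infinitely_derivable_affine _ c h infinitely_derivable_smooth_step.
have -> : plateau h a b = (fun x => smooth_step ((x - a) / h) +
    (-1) * smooth_step ((x - b) / h)).
  by apply/funext => x; rewrite mulN1r.
apply: infinitely_derivableD => //; apply: infinitely_derivableM => //.
exact: infinitely_derivable_cst.
Qed.

Lemma plateau_out h a b x : 0 < h -> a <= b -> x \notin `[a, b + h] ->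
  plateau h a b x = 0.
Proof.
move=> h0 ab; rewrite in_itv/= negb_and -!ltNge => /orP[xa|bx]; rewrite /plateau.
  rewrite !smooth_step_le0 ?subrr// pmulr_lle0 ?invr_gt0// subr_le0 ltW//.
  exact: lt_le_trans ab.
rewrite !smooth_step_ge1 ?subrr// ler_pdivlMr// mul1r lerBrDl ltW//.
by apply: le_lt_trans bx; rewrite lerD2r.
Qed.

Lemma plateau_ge0 h a b x : 0 < h -> a <= b -> 0 <= plateau h a b x.
Proof.
move=> h0 ab; rewrite subr_ge0 smooth_step_homo// ler_pM2r ?invr_gt0//.
by rewrite lerD2l lerN2.
Qed.

Lemma plateau_le1 h a b x : plateau h a b x <= 1.
Proof. by rewrite lerBlDr ler_wpDr ?smooth_step_ge0 ?smooth_step_le1. Qed.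

Lemma plateau_in h a b x : 0 < h -> a + h <= x <= b -> plateau h a b x = 1.
Proof.
move=> h0 /andP[ax xb]; rewrite /plateau smooth_step_ge1 ?smooth_step_le0 ?subr0//.
  by rewrite pmulr_lle0 ?invr_gt0// subr_le0.
by rewrite ler_pdivlMr// mul1r lerBrDl.
Qed.

Lemma derive1_smooth_step_out x : x \notin `[0, 1] -> derive1 smooth_step x = 0.
Proof.
apply: (derive1_eq0_out _ _ 1) => y.
  by move=> /ltW; exact: smooth_step_le0.
by move=> /ltW; exact: smooth_step_ge1.
Qed.

Lemma derive1_plateau h a b : derive1 (plateau h a b) =
  (fun x => h^-1 * derive1 smooth_step ((x - a) / h)
          - h^-1 * derive1 smooth_step ((x - b) / h)).
Proof.
apply/funext => x; rewrite derive1E.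
have dS (c : R) : derivable (fun x => smooth_step ((x - c) / h)) x 1.
  apply: infinitely_derivable_derivable.
  exact/infinitely_derivable_affine/infinitely_derivable_smooth_step.
rewrite (deriveB (dS a) (dS b)) -!derive1E !derive1_affine//;
  exact: infinitely_derivable_smooth_step.
Qed.

Lemma derive1n_plateau n a b : derive1n n (plateau 1 a b) =
  (fun x => derive1n n smooth_step (x - a) - derive1n n smooth_step (x - b)).
Proof.
pose S := derive1n n (@smooth_step R).
suff H : derive1n n (plateau 1 a b) = (fun x => S ((x - a) / 1) - S ((x - b) / 1)).
  by rewrite H; apply/funext => x; rewrite !divr1.
rewrite {}/S; elim: n => [//|n IHn]; rewrite derive1nS IHn.
apply/funext => x; rewrite derive1E.
have dn : infinitely_derivable (derive1n n (@smooth_step R)).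
  exact/infinitely_derivable_derive1n/infinitely_derivable_smooth_step.
have dS (c : R) : derivable (fun x => derive1n n smooth_step ((x - c) / 1)) x 1.
  exact/infinitely_derivable_derivable/infinitely_derivable_affine.
by rewrite (deriveB (dS a) (dS b)) -!derive1E !derive1_affine// invr1 !mul1r derive1nS.
Qed.

Lemma derive1n_smooth_step_out n x : x \notin `[0, 1] ->
  derive1n n.+1 smooth_step x = 0.
Proof.
rewrite /derive1n iterSr -/(derive1n n _).
exact/derive1n_eq0_out/derive1_smooth_step_out.
Qed.

(** The two edges of the plateau are translates of a fixed profile, so the
    bound does not depend on its length. *)
Lemma plateau_pairing_bound n (M : R) : exists C : R, forall (f : R -> R) a b,
  L2 f -> \int[lebesgue_on half_line]_x (f x ^+ 2) <= M ->
  `|\int[lebesgue_on half_line]_x (f x * derive1n n.+1 (plateau 1 a b) x)| <= C.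
Proof.
set S := derive1n n.+1 (@smooth_step R).
have dS : infinitely_derivable S.
  exact/infinitely_derivable_derive1n/infinitely_derivable_smooth_step.
have S01 x : x \notin `[0, 1] -> S x = 0 by exact: derive1n_smooth_step_out.
have [C C0 SC] := bounded_of_continuous 0 1 S
  (infinitely_derivable_continuous _ dS) S01.
exists ((M + C ^+ 2) + (M + C ^+ 2)) => f a b f2 fM.
have cS c : continuous (fun x => S (x - c)).
  move=> x; apply: (@continuous_comp _ _ _ (fun x => x - c) S).
    by apply: continuousB; [exact: cvg_id|exact: cvg_cst].
  exact: infinitely_derivable_continuous.
have Sc c x : x \notin `[c, c + 1] -> S (x - c) = 0.
  move=> xc; apply: S01; apply: contra xc; rewrite !in_itv/=.
  by rewrite subr_ge0 lerBlDl.
have Sc2 c : L2 (fun x => S (x - c)) by exact: L2_of_supported (Sc c).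
have bound c : `|\int[lebesgue_on half_line]_x (f x * S (x - c))| <= M + C ^+ 2.
  apply: le_trans (Rintegral_L2_mul_le _ _ f2 (Sc2 c)) _; apply: lerD => //.
  have := Rintegral_sqr_le C c (c + 1) _ _ (cS c) (Sc c).
  by rewrite addrAC subrr add0r mulr1; apply => //; rewrite lerDl.
rewrite derive1n_plateau -/S; under eq_Rintegral do rewrite mulrBr.
rewrite RintegralB//; last 2 first.
  exact: L2_mul_integrable (Sc2 a).
  exact: L2_mul_integrable (Sc2 b).
by apply: le_trans (ler_normB _ _) _; apply: lerD.
Qed.

End Plateau.

(** * Recovering the end values from weak time derivatives *)

Section EndValues.
Context {R : realType}.
Implicit Types (T a b h c e x t : R) (g m : R -> R).

Lemma integrable_within_continuous T g : {within `[0, T], continuous g} ->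
  lebesgue_measure.-integrable `]0, T[ (EFin \o g).
Proof.
move=> cg; have icc : lebesgue_measure.-integrable `[0, T] (EFin \o g).
  by apply: continuous_compact_integrable => //; exact: segment_compact.
by apply: (integrableS _ _ _ icc) => //; exact: subset_itv_oo_cc.
Qed.

Lemma within_continuousM T g m : {within `[0, T], continuous m} ->
  continuous g -> {within `[0, T], continuous (fun t => m t * g t)}.
Proof.
move=> cm cg t; apply: (@continuousM _ (subspace `[0, T]) m g t); first exact: cm.
exact: (continuous_subspaceT cg).
Qed.

(** The kernel is the derivative of a function that climbs from [0] to [1]
    within [[0, T]]. *)
Lemma Rintegral_edge T c h : 0 < h -> 0 <= c -> c + h <= T ->
  \int[lebesgue_measure]_(t in `]0, T[)
    (h^-1 * derive1 smooth_step ((t - c) / h)) = 1.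
Proof.
move=> h0 c0 chT.
have dS := @infinitely_derivable_smooth_step R.
have dSc := infinitely_derivable_affine _ c h dS.
pose F t := smooth_step ((t - c) / h); pose f := derive1 F.
have cf : continuous f.
  exact/infinitely_derivable_continuous/infinitely_derivable_derive1.
have T0 : 0 < T by apply: lt_le_trans chT; rewrite ltr_wpDl.
under eq_Rintegral => t _.
  have -> : h^-1 * derive1 smooth_step ((t - c) / h) = f t.
    by rewrite /f /F derive1_affine.
  over.
have mf : measurable_fun setT f by exact: continuous_measurable_fun.
rewrite /Rintegral integral_itv_obnd_cbnd; last first.
  by apply/measurable_EFinP; apply: measurable_funS mf.
rewrite integral_itv_bndo_bndc; last first.
  by apply/measurable_EFinP; apply: measurable_funS mf.
rewrite (@continuous_FTC2 _ f F)//.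
- rewrite /F smooth_step_ge1; last by rewrite ler_pdivlMr// mul1r lerBrDl.
  rewrite smooth_step_le0 ?sube0//.
  by rewrite pmulr_lle0 ?invr_gt0// subr_le0.
- exact: continuous_subspaceT.
- split => [t _||]; first exact: infinitely_derivable_derivable.
    by apply: cvg_at_right_filter; exact: infinitely_derivable_continuous.
  by apply: cvg_at_left_filter; exact: infinitely_derivable_continuous.
Qed.

(** The kernel is nonnegative, of mass one and supported in [[c, c + h]], so the
    integral is a weighted mean of [m] over that window. *)
Lemma edge_average T c h m (A e : R) : 0 < h -> 0 <= c -> c + h <= T ->
  {within `[0, T], continuous m} ->
  (forall t, t \in `[0, T] -> t \in `[c, c + h] -> `|m t - A| <= e) ->
  `|\int[lebesgue_measure]_(t in `]0, T[)
      (m t * (h^-1 * derive1 smooth_step ((t - c) / h))) - A| <= e.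
Proof.
move=> h0 c0 chT cm mA; set k := fun t => h^-1 * derive1 smooth_step ((t - c) / h).
have dk : infinitely_derivable k.
  have -> : k = derive1 (fun t => smooth_step ((t - c) / h)).
    by rewrite derive1_affine//; exact: infinitely_derivable_smooth_step.
  apply/infinitely_derivable_derive1/infinitely_derivable_affine.
  exact: infinitely_derivable_smooth_step.
have ck := infinitely_derivable_continuous _ dk.
have k0 t : 0 <= k t.
  by rewrite mulr_ge0 ?derive1_smooth_step_ge0// invr_ge0 ltW.
have k1 : \int[lebesgue_measure]_(t in `]0, T[) k t = 1 by exact: Rintegral_edge.
have ik : lebesgue_measure.-integrable `]0, T[ (EFin \o k).
  by apply: integrable_within_continuous; exact: continuous_subspaceT.
have imk : lebesgue_measure.-integrable `]0, T[ (EFin \o (fun t => m t * k t)).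
  by apply: integrable_within_continuous; exact: within_continuousM.
have icst (B : R) : lebesgue_measure.-integrable `]0, T[ (EFin \o (fun t => B * k t)).
  apply: integrable_within_continuous; apply: within_continuousM => //.
  by apply: continuous_subspaceT; exact: cst_continuous.
have imAk : lebesgue_measure.-integrable `]0, T[
    (EFin \o (fun t => (m t - A) * k t)).
  apply: integrable_within_continuous; apply: within_continuousM => //.
  by move=> t; apply: continuousB; [exact: cm|exact: cst_continuous].
rewrite -[A]mulr1 -[in A * 1]k1 -RintegralZl// -RintegralB//.
under eq_Rintegral do rewrite -mulrBl.
apply: le_trans (le_normr_Rintegral _ imAk) _ => //.
rewrite -[e]mulr1 -[in e * 1]k1 -RintegralZl//; apply: le_Rintegral => //.
  exact: (integrable_norm imAk).
move=> t tT; rewrite normrM (ger0_norm (k0 t)).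
have [tc|tc] := boolP (t \in `[c, c + h]).
  by rewrite ler_wpM2r// mA//; exact: subset_itv_oo_cc tT.
suff -> : k t = 0 by rewrite !mulr0.
rewrite /k derive1_smooth_step_out ?mulr0//; apply: contra tc.
rewrite !in_itv/= pmulr_lge0 ?invr_gt0// subr_ge0 ler_pdivrMr// mul1r.
by rewrite lerBlDl.
Qed.

(** The derivative of the plateau averages [m] over [[h, 2 h]] and subtracts its
    average over [[T - 2 h, T - h]]; by continuity, these tend to the end values
    as [h] tends to [0]. *)
Lemma plateau_end_values T m (e : R) : 0 < T -> 0 < e ->
  {within `[0, T], continuous m} ->
  exists h, [/\ 0 < h, h <= T - 2 * h &
    m 0 - m T <= \int[lebesgue_measure]_(t in `]0, T[)
      (m t * derive1 (plateau h h (T - 2 * h)) t) + e].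
Proof.
have triangle (p q M0 MT : R) : `|p - M0| <= e / 2 -> `|q - MT| <= e / 2 ->
    M0 - MT <= p - q + e.
  by rewrite !ler_norml => /andP[? _] /andP[_ ?]; lra.
move=> T0 e0 cm.
have near_end (s : R) : s \in `[0, T] -> exists2 d : R, 0 < d &
    forall t, t \in `[0, T] -> `|t - s| <= d -> `|m t - m s| <= e / 2.
  move=> sT; have /subspace_continuousP/(_ s sT) := cm.
  move=> /cvgrPdist_le/(_ (e / 2)); rewrite divr_gt0// => /(_ isT).
  rewrite near_withinE => -[d /= d0 H]; exists (d / 2); first by rewrite divr_gt0.
  move=> t tT ts; rewrite distrC; apply: H => //=.
  by rewrite distrC (le_lt_trans ts)// ltr_pdivrMr// ltr_pMr// ltr1n.
have sT0 : 0 \in `[0, T] by rewrite in_itv/= lexx ltW.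
have sTT : T \in `[0, T] by rewrite in_itv/= lexx ltW.
have [d0 d0_gt0 Hd0] := near_end _ sT0; have [d1 d1_gt0 Hd1] := near_end _ sTT.
pose h := Num.min (T / 4) (Num.min (d0 / 2) (d1 / 2)).
have h0 : 0 < h by rewrite !lt_min !divr_gt0.
have hT : h <= T / 4 by rewrite ge_min lexx.
have hd0 : h <= d0 / 2 by rewrite !ge_min lexx !orbT.
have hd1 : h <= d1 / 2 by rewrite !ge_min lexx !orbT.
exists h; split => //; first lra.
pose I c := \int[lebesgue_measure]_(t in `]0, T[)
  (m t * (h^-1 * derive1 smooth_step ((t - c) / h))).
have I0 : `|I h - m 0| <= e / 2.
  apply: edge_average => //; [exact: ltW|lra|].
  move=> t tT; rewrite in_itv/= => /andP[ht th]; apply: Hd0 => //.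
  by rewrite subr0 ger0_norm; lra.
have I1 : `|I (T - 2 * h) - m T| <= e / 2.
  apply: edge_average => //; [lra|lra|].
  move=> t tT; rewrite in_itv/= => /andP[ht th]; apply: Hd1 => //.
  by rewrite distrC ger0_norm; lra.
have -> : \int[lebesgue_measure]_(t in `]0, T[)
    (m t * derive1 (plateau h h (T - 2 * h)) t) = I h - I (T - 2 * h).
  rewrite derive1_plateau; under eq_Rintegral do rewrite mulrBr.
  have ck c : continuous (fun t => h^-1 * derive1 smooth_step ((t - c) / h)).
    rewrite -derive1_affine; last exact: infinitely_derivable_smooth_step.
    apply/infinitely_derivable_continuous/infinitely_derivable_derive1.
    exact/infinitely_derivable_affine/infinitely_derivable_smooth_step.
  by rewrite RintegralB//; apply: integrable_within_continuous;
    exact: within_continuousM.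
exact: triangle I0 I1.
Qed.

Lemma Rintegral_ae_bound T m g (C : R) : 0 < T -> 0 <= C ->
  {within `[0, T], continuous m} -> continuous g ->
  (forall t, `|g t| <= 1) ->
  (\forall t \ae lebesgue_on (time_interval T), `|m t| <= C) ->
  `|\int[lebesgue_measure]_(t in `]0, T[) (m t * g t)| <= C * T.
Proof.
move=> T0 C0 cm cg g1 mC.
have img : lebesgue_measure.-integrable `]0, T[ (EFin \o (fun t => m t * g t)).
  by apply: integrable_within_continuous; exact: within_continuousM.
apply: le_trans (le_normr_Rintegral _ img) _ => //.
have inorm := integrable_norm img.
have le_cst : (\int[lebesgue_measure]_(t in `]0%R, T[) `|(m t * g t)%:E| <=
    \int[lebesgue_measure]_(t in `]0%R, T[) C%:E)%E.
  apply: ae_ge0_le_integral => //.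
  - by case/integrableP : inorm.
  - apply/(ae_lebesgue_onP _ (fun t => _)); apply: filterS mC => t mt.
    by rewrite /= lee_fin normrM -[C]mulr1 ler_pM.
rewrite /Rintegral -lee_fin fineK; last exact: integrable_fin_num inorm.
apply: le_trans le_cst _.
rewrite integral_cst//= lebesgue_measure_itv/= lte_fin T0.
by rewrite -EFinD subr0 -EFinM.
Qed.

End EndValues.

(** * A square-integrable initial datum of infinite mass *)

Section InitialDatum.
Context {R : realType}.
Implicit Types (r x : R).

Definition slow_decay x : R := (1 + `|x|)^-1.

Lemma slow_decay_gt0 x : 0 < slow_decay x.
Proof. by rewrite invr_gt0 ltr_wpDr. Qed.

Lemma continuous_slow_decay : continuous slow_decay.
Proof.
move=> x; apply: cvgV; first by rewrite gt_eqF// ltr_wpDr.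
by apply: cvgD; [exact: cvg_cst|exact: cvg_norm].
Qed.

Lemma slow_decayE x : 0 <= x -> slow_decay x = (1 + x)^-1.
Proof. by move=> x0; rewrite /slow_decay ger0_norm. Qed.

Let is_derive_1D x : is_derive x (1 : R) (fun x => 1 + x) 1.
Proof.
have := is_deriveD (is_derive_cst (1 : R) x (1 : R)) (is_derive_id x (1 : R)).
by rewrite add0r.
Qed.

Lemma L2_slow_decay : L2 slow_decay.
Proof.
have c2 : continuous (fun x => slow_decay x ^+ 2).
  by move=> x; apply: (@continuous_comp _ _ _ slow_decay (fun y => y ^+ 2));
    [exact: continuous_slow_decay|exact: exprn_continuous].
apply/L2P; split.
  by apply: continuous_measurable_fun; exact: continuous_slow_decay.
apply/integrableP; split.
  by apply/measurable_EFinP; exact: continuous_measurable_fun.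
under eq_integral do rewrite gee0_abs ?lee_fin ?sqr_ge0//.
rewrite integral_mrestr integral_itv_obnd_cbnd; last first.
  apply/measurable_EFinP; apply: (@measurable_funS _ _ _ _ setT) => //.
  exact: continuous_measurable_fun.
have dF (x : R) : 0 <= x ->
    is_derive x (1 : R) (fun x => - (1 + x)^-1) ((1 + x) ^- 2).
  move=> x0; have xn0 : 1 + x != 0 by rewrite gt_eqF// ltr_wpDr.
  apply: is_derive_eq (is_deriveN (is_deriveV xn0 (is_derive_1D x))) _.
  by rewrite [_ *: _]mulr1 opprK.
rewrite (@ge0_continuous_FTC2y _ _ (fun x => - (1 + x)^-1) 0 0).
- by rewrite addr0 invr1 sub0e EFinN oppeK ltry.
- by move=> x _; rewrite sqr_ge0.
- exact: continuous_subspaceT.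
- rewrite -oppr0; apply: cvgN; apply/gtr0_cvgV0; last exact: cvg_addrl.
  by near=> x; rewrite addr_gt0//; near: x; exact: nbhs_pinfty_gt.
- by move=> x x0; have [] := dF x (ltW x0).
- apply: cvg_at_right_filter.
  have /derivable1_diffP/differentiable_continuous :
    derivable (fun x : R => - (1 + x)^-1) 0 1 by have [] := dF 0 (lexx _).
  exact.
- move=> x; rewrite in_itv/= andbT => x0; rewrite derive1E.
  by have [_ ->] := dF x (ltW x0); rewrite slow_decayE ?ltW// exprVn.
Unshelve. all: by end_near. Qed.

(** The plateau function equals [1] on [[2, r]], where the datum has the
    primitive [ln (1 + x)]. *)
Lemma slow_decay_mass r : 2 < r -> ln (1 + r) - ln 3 <=
  distr_of_L2 slow_decay (plateau 1 1 r).
Proof.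
move=> r2.
have r1 : 1 <= r by rewrite ltW// (lt_trans _ r2)// ltr1n.
have cp : continuous (plateau 1 1 r).
  exact/infinitely_derivable_continuous/infinitely_derivable_plateau.
have cup : continuous (fun x => slow_decay x * plateau 1 1 r x).
  by move=> x; apply: continuousM; [exact: continuous_slow_decay|exact: cp].
have up0 x : 0 <= slow_decay x * plateau 1 1 r x.
  by rewrite mulr_ge0 ?plateau_ge0// ltW// slow_decay_gt0.
have iup : lebesgue_measure.-integrable `]0, +oo[
    (EFin \o (fun x => slow_decay x * plateau 1 1 r x)).
  apply/integrable_lebesgue_on; first exact: continuous_measurable_fun.
  apply: (integrable_of_supported _ 1 (r + 1)) => // x xr.
  by rewrite plateau_out ?mulr0.
rewrite /distr_of_L2 Rintegral_lebesgue_on /Rintegral -lee_fin fineK; last first.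
  exact: integrable_fin_num iup.
have dln (x : R) : 0 < x -> is_derive x (1 : R) (fun x => ln (1 + x)) (1 + x)^-1.
  move=> x0; rewrite -[_^-1]mulr1; apply: (@is_derive1_comp _ (@ln R) (fun x => 1 + x)).
    by apply: is_derive1_ln; rewrite addr_gt0.
  exact: is_derive_1D.
have cln (y : R) : 0 < y -> {for y, continuous (fun x : R => ln (1 + x))}.
  move=> y0; have [/derivable1_diffP/differentiable_continuous + _] := dln y y0.
  exact.
have FTC : (\int[lebesgue_measure]_(x in `[2%R, r]) (slow_decay x)%:E =
    (ln (1 + r))%:E - (ln (1 + 2))%:E)%E.
  apply: (@continuous_FTC2 _ _ (fun x => ln (1 + x)) _ _ r2).
  - exact/continuous_subspaceT/continuous_slow_decay.
  - split.
    + move=> x; rewrite in_itv/= => /andP[x2 _].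
      by have [] := dln x (lt_trans _ x2).
    + by apply: cvg_at_right_filter; exact: cln.
    + by apply: cvg_at_left_filter; apply: cln; rewrite (lt_trans _ r2).
  - move=> x; rewrite in_itv/= => /andP[x2 _].
    have x0 : 0 < x by exact: lt_trans x2.
    by rewrite derive1E; have [_ ->] := dln x x0; rewrite slow_decayE// ltW.
have -> : (ln (1 + r) - ln 3)%:E = ((ln (1 + r))%:E - (ln (1 + 2))%:E)%E :> \bar R.
  by rewrite -EFinB; congr (_ - ln _)%:E; rewrite -natr1 addrC.
rewrite -{}FTC.
have -> : (\int[lebesgue_measure]_(x in `[2%R, r]) (slow_decay x)%:E =
    \int[lebesgue_measure]_(x in `[2%R, r]) (slow_decay x * plateau 1 1 r x)%:E)%E.
  apply: eq_integral => x; rewrite inE/= in_itv/= => xr.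
  by rewrite plateau_in ?mulr1.
apply: ge0_subset_integral => //.
- by case/integrableP : iup.
- by move=> x _; rewrite lee_fin.
- by move=> x /=; rewrite !in_itv/= andbT => /andP[+ _]; exact: lt_le_trans.
Qed.

End InitialDatum.

(** * Testing the equation against a product *)

Section Assembly.
Context {R : realType}.

Lemma distr_of_Loo_L2_tensor (T : R) u U (f g : R -> R) (a b : R) :
  Loo_L2 T u -> continuous_representative T u U ->
  infinitely_derivable f -> (forall x, x \notin `[a, b] -> f x = 0) -> 0 < a ->
  distr_of_Loo_L2 T u (fun z => f z.1 * g z.2) =
  \int[lebesgue_measure]_(t in `]0, T[) (U t f * g t).
Proof.
move=> [uL2 _ _] [_ _ Uu] df fab a0; rewrite -Rintegral_lebesgue_on.
apply: ae_eq_Rintegral_lebesgue_on; apply: filterS2 uL2 Uu => t ut2 Utu /=.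
have abO : `[a, b]%classic `<=` [set` @half_line R].
  by move=> x /=; rewrite !in_itv/= andbT => /andP[+ _]; exact: lt_le_trans.
rewrite (Utu f (test_function_itv _ _ _ _ df abO fab)) /distr_of_L2.
rewrite -RintegralZr//; first by apply: eq_Rintegral => x _; rewrite mulrA.
apply: L2_mul_integrable => //.
exact: L2_of_supported (infinitely_derivable_continuous _ df) fab.
Qed.

Lemma tested_equation (T : R) u (a b c d : R) (f g : R -> R) :
  infinitely_derivable f -> infinitely_derivable g ->
  (forall x, x \notin `[a, b] -> f x = 0) ->
  (forall t, t \notin `[c, d] -> g t = 0) ->
  0 < a -> 0 < c -> d < T ->
  distr_eq (space_time T)
    (d_t (distr_of_Loo_L2 T u)
       \- d_x (d_x (d_x (distr_of_Loo_L2 T u)))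
       \- d_x (d_x (distr_of_Loo_L2 T u)))
    (cst 0) ->
  distr_of_Loo_L2 T u (fun z => f z.1 * derive1 g z.2) =
  distr_of_Loo_L2 T u (fun z => derive1n 3 f z.1 * g z.2)
  - distr_of_Loo_L2 T u (fun z => derive1n 2 f z.1 * g z.2).
Proof.
move=> df dg fab gcd a0 c0 dT eqn.
have dfn n := infinitely_derivable_derive1n n f df.
(* [F] and [G] are kept abstract: only [DxF] and [DtF] matter from here on. *)
have [F FE] : {F : nat -> R * R -> R |
    forall n, F n = (fun z => derive1n n f z.1 * g z.2)}.
  by exists (fun n z => derive1n n f z.1 * g z.2).
have [G GE] : {G : R * R -> R | G = (fun z => f z.1 * derive1 g z.2)}.
  by exists (fun z => f z.1 * derive1 g z.2).
have DxF n : 'D_((1, 0) : R * R) (F n) = F n.+1.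
  by rewrite !FE; exact: (derive_tensor_x (derive1n n f) g (dfn n) dg).
have DtF : 'D_((0, 1) : R * R) (F 0%N) = G.
  by rewrite GE FE; exact: derive_tensor_t.
have tF : test_function (space_time T) (F 0%N).
  by rewrite FE; exact: test_function_tensor fab gcd a0 c0 dT.
suff : distr_of_Loo_L2 T u G =
    distr_of_Loo_L2 T u (F 3%N) - distr_of_Loo_L2 T u (F 2%N).
  by rewrite GE (FE 2%N) (FE 3%N).
move: (distr_of_Loo_L2 T u) (eqn (F 0%N) tF) => D {}eqn.
have : - D ('D_((0, 1) : R * R) (F 0%N))
    - - - - D ('D_((1, 0) : R * R) ('D_((1, 0) : R * R) ('D_((1, 0) : R * R) (F 0%N))))
    - - - D ('D_((1, 0) : R * R) ('D_((1, 0) : R * R) (F 0%N))) = 0 := eqn.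
rewrite DtF (DxF 0%N) (DxF 1%N) (DxF 2%N) !opprK -addrA addrC => /eqP.
by rewrite subr_eq0 => /eqP.
Qed.

Lemma tested_pairings (T : R) u U (a b c d : R) (f g : R -> R) :
  infinitely_derivable f -> infinitely_derivable g ->
  (forall x, x \notin `[a, b] -> f x = 0) ->
  (forall t, t \notin `[c, d] -> g t = 0) ->
  0 < a -> 0 < c -> d < T -> Loo_L2 T u ->
  distr_eq (space_time T)
    (d_t (distr_of_Loo_L2 T u)
       \- d_x (d_x (d_x (distr_of_Loo_L2 T u)))
       \- d_x (d_x (distr_of_Loo_L2 T u)))
    (cst 0) ->
  continuous_representative T u U ->
  \int[lebesgue_measure]_(t in `]0, T[) (U t f * derive1 g t) =
  \int[lebesgue_measure]_(t in `]0, T[) (U t (derive1n 3 f) * g t)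
  - \int[lebesgue_measure]_(t in `]0, T[) (U t (derive1n 2 f) * g t).
Proof.
move=> df dg fab gcd a0 c0 dT uL2 eqn Uu.
have tensor n k := distr_of_Loo_L2_tensor T u U (derive1n n f) k a b uL2 Uu
  (infinitely_derivable_derive1n n f df) (derive1n_eq0_out a b f n fab) a0.
have eq0 := tensor 0%N (derive1 g); have eq2 := tensor 2%N g.
have eq3 := tensor 3%N g.
transitivity (distr_of_Loo_L2 T u (fun z => f z.1 * derive1 g z.2)).
  exact: esym eq0.
apply: etrans (congr2 (fun p q => p - q) eq3 eq2).
exact: (tested_equation T u a b c d f g).
Qed.

Lemma plateau_supported n (r : R) : 1 <= r ->
  forall x, x \notin `[1, r + 1] -> derive1n n (plateau 1 1 r) x = 0.
Proof.
by move=> r1; apply: derive1n_eq0_out => x; exact: plateau_out.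
Qed.

(** For almost every [t] the pairing is that of [u t], to which the uniform bound
    on the edges of the plateau applies. *)
Lemma pairing_bound n (T : R) u U : 0 < T -> Loo_L2 T u ->
  continuous_representative T u U -> exists C : R,
  forall (r : R) (g : R -> R), 1 <= r -> continuous g ->
    (forall t, `|g t| <= 1) ->
  `|\int[lebesgue_measure]_(t in `]0, T[)
     (U t (derive1n n.+1 (plateau 1 1 r)) * g t)| <= C.
Proof.
move=> T0 uL2 Uu; have [M uM] := Loo_L2_bound T u uL2.
have [C HC] := @plateau_pairing_bound R n M.
exists (`|C| * T) => r g r1 cg g1; set f := derive1n _ _.
have df : infinitely_derivable f.
  exact/infinitely_derivable_derive1n/infinitely_derivable_plateau.
have fr := plateau_supported n.+1 r r1.
apply: Rintegral_ae_bound => //.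
  exact: continuous_representative_pairing df fr ltr01 Uu.
have [_ _ Uae] := Uu; apply: filterS2 uM Uae => t [ut2 utM] ->.
  by apply: le_trans (ler_norm C); exact: HC.
apply: (test_function_itv _ 1 (r + 1)) => //.
by move=> x /=; rewrite !in_itv/= andbT => /andP[+ _]; exact: lt_le_trans.
Qed.

(** The constant does not depend on [r], since only derivatives of the plateau
    function of order two and three occur. *)
Lemma end_values_bound (T : R) u U : 0 < T -> Loo_L2 T u ->
  distr_eq (space_time T)
    (d_t (distr_of_Loo_L2 T u)
       \- d_x (d_x (d_x (distr_of_Loo_L2 T u)))
       \- d_x (d_x (distr_of_Loo_L2 T u)))
    (cst 0) ->
  continuous_representative T u U -> exists C : R, forall r, 1 <= r ->
  U 0 (plateau 1 1 r) - U T (plateau 1 1 r) <= C.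
Proof.
move=> T0 uL2 eqn Uu.
have [C2 H2] := pairing_bound 1 T u U T0 uL2 Uu.
have [C3 H3] := pairing_bound 2 T u U T0 uL2 Uu.
exists (C3 + C2 + 1) => r r1.
have dp := @infinitely_derivable_plateau R 1 1 r.
have pr n := plateau_supported n r r1.
have cm := continuous_representative_pairing T u U 1 (r + 1) _ dp (pr 0%N) ltr01 Uu.
have [h [h0 hT]] := plateau_end_values T _ 1 T0 ltr01 cm.
move/le_trans; apply; apply: lerD => //.
have dq := @infinitely_derivable_plateau R h h (T - 2 * h).
have cq := infinitely_derivable_continuous _ dq.
have q1 t : `|plateau h h (T - 2 * h) t| <= 1.
  by rewrite ger0_norm ?plateau_ge0 ?plateau_le1.
have hTh : T - 2 * h + h < T by lra.
rewrite (tested_pairings T u U 1 (r + 1) h (T - 2 * h + h) _ _ dp dq (pr 0%N)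
  (fun t => plateau_out _ _ _ t h0 hT) ltr01 h0 hTh uL2 eqn Uu).
apply: le_trans (ler_norm _) _; apply: le_trans (ler_normB _ _) _.
by apply: lerD; [exact: H3|exact: H2].
Qed.

End Assembly.

Theorem theorem2p3 (R : realType) (T : R) (hT : 0 < T) :
  exists2 u0 : R -> R, L2 u0 &
    forall (u : R -> R -> R) (U : R -> (R -> R) -> R),
      Loo_L2 T u ->
      distr_eq (space_time T)
        (d_t (distr_of_Loo_L2 T u)
           \- d_x (d_x (d_x (distr_of_Loo_L2 T u)))
           \- d_x (d_x (distr_of_Loo_L2 T u)))
        (cst 0) ->
      continuous_representative T u U ->
      distr_eq [set` half_line] (U 0) (distr_of_L2 u0) ->
      ~ distr_eq [set` half_line] (U T) (cst 0).
Proof.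
exists slow_decay; first exact: L2_slow_decay.
move=> u U uL2 eqn Uu U0 UT.
have [C UC] := end_values_bound T u U hT uL2 eqn Uu.
(* This [r] satisfies [3 * expR C < 1 + r], that is, [C < ln (1 + r) - ln 3]. *)
pose r := 2 + 3 * expR `|C|.
have r2 : 2 < r by rewrite ltrDl mulr_gt0// expR_gt0.
have r1 : 1 <= r by apply: ltW; apply: lt_trans r2; rewrite ltr1n.
have tr : test_function [set` half_line] (plateau 1 1 r).
  apply: (test_function_itv _ 1 (r + 1)).
  - exact: infinitely_derivable_plateau.
  - by move=> x /=; rewrite !in_itv/= andbT => /andP[+ _]; exact: lt_le_trans.
  - by move=> x xr; apply: plateau_out.
have := UC r r1; rewrite (U0 _ tr) (UT _ tr) /= subr0 leNgt => /negP; apply.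
apply: lt_le_trans (slow_decay_mass _ r2).
apply: le_lt_trans (ler_norm _) _; rewrite -[ltLHS](expRK `|C|) ltrBrDl -lnM ?posrE ?expR_gt0//.
by rewrite ltr_ln ?posrE /r ?addr_gt0 ?mulr_gt0 ?expR_gt0// addrA ltrDr.
Qed.
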